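(* For every $\alpha>0$ there is $\delta>0$ such that for every sufficiently large $n$, every $2$-edge-colouring of $K_n^{(3)}$ satisfies at least one of the following properties: (1) There are at least $\delta n^6$ gadgets. (2) There is a partition $[n]=X\cup Y$ such that, after changing the colour of at most $\alpha n^3$ edges, the following holds: all edges contained in $X$ and all edges contained in $Y$ have the same colour, and all edges intersecting both $X$ and $Y$ have the other colour.
   Context: $[n]=\{1,\dots,n\}$, and $K_n^{(3)}$ is the complete $3$-uniform hypergraph on $[n]$ (edges are all $3$-subsets of $[n]$). A $2$-edge-colouring assigns one of two colours to each edge, arbitrarily. In a partition $[n]=X\cup Y$ the sets are disjoint and one of them may be empty. Let $K^{(3)}_{2,2,2}$ be the complete $3$-partite $3$-uniform hypergraph with three parts of size $2$. With vertex set $\{1,\dots,6\}$ and parts $\{1,2\},\{3,4\},\{5,6\}$, its $8$ edges decompose (uniquely) into the two edge-disjoint Pasch configurations $\{135,146,236,245\}$ and $\{136,145,235,246\}$, where a Pasch configuration is a $3$-uniform hypergraph isomorphic to the one on $6$ vertices with edges $135,146,236,245$. In an edge-colouring of $K_n^{(3)}$, a gadget is a copy $K$ of $K^{(3)}_{2,2,2}$ in $K_n^{(3)}$ (as a subgraph) for which there is a colour $c$ such that the two Pasch configurations decomposing $K$ have a different number of edges of colour $c$. *)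

(* Defs.v *)
From mathcomp Require Import all_boot all_order all_algebra.
From mathcomp Require Import reals.

Set Implicit Arguments.
Unset Strict Implicit.
Unset Printing Implicit Defensive.

(* A hypergraph on V is identified with its edge set, of type {set {set V}};
   none of the hypergraphs copied below has isolated vertices. *)

Definition edge (n : nat) := {e : {set 'I_n} | #|e| == 3}.

Definition colouring (n : nat) := {ffun edge n -> bool}.

Definition is_copy (V W : finType) (H : {set {set W}}) (G : {set {set V}}) : bool :=
  [exists f : {ffun W -> V}, injectiveb f && (G == [set f @: e | e : {set W} in H])].

(* The vertices 1, ..., 6 are encoded as 0, ..., 5 in 'I_6. *)
Definition vtx (k : nat) : 'I_6 := inord k.-1.

Definition triple (i j k : nat) : {set 'I_6} := [set vtx i; vtx j; vtx k].

Definition K222 : {set {set 'I_6}} :=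
  [set e : {set 'I_6} | [&& #|e :&: [set vtx 1; vtx 2]| == 1,
                            #|e :&: [set vtx 3; vtx 4]| == 1
                          & #|e :&: [set vtx 5; vtx 6]| == 1]].

Definition Pasch : {set {set 'I_6}} :=
  [set triple 1 3 5; triple 1 4 6; triple 2 3 6; triple 2 4 5].

Definition num_coloured (n : nat) (col : colouring n) (c : bool)
    (P : {set {set 'I_n}}) : nat :=
  #|[set e : edge n | (val e \in P) && (col e == c)]|.

(* K222 has exactly one decomposition into two Pasch configurations, so
   quantifying existentially over {P1, P2} just names that decomposition. *)
Definition is_gadget (n : nat) (col : colouring n) (K : {set {set 'I_n}}) : bool :=
  is_copy K222 K &&
  [exists P1 : {set {set 'I_n}}, exists P2 : {set {set 'I_n}},
    [&& is_copy Pasch P1, is_copy Pasch P2, [disjoint P1 & P2], P1 :|: P2 == K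
      & [exists c : bool, num_coloured col c P1 != num_coloured col c P2]]].

Definition gadgets (n : nat) (col : colouring n) : {set {set {set 'I_n}}} :=
  [set K | is_gadget col K].

Definition changed (n : nat) (col col' : colouring n) : {set edge n} :=
  [set e | col e != col' e].

Definition partition_coloured (n : nat) (col : colouring n) (X Y : {set 'I_n}) : Prop :=
  exists c : bool, forall e : edge n,
    ((val e \subset X) || (val e \subset Y) -> col e = c) /\
    ((val e :&: X != set0) && (val e :&: Y != set0) -> col e = ~~ c).

(* Main.v *)
Require Import Defs.
From mathcomp Require Import all_boot all_order all_algebra.
From mathcomp Require Import reals.
From mathcomp Require Import perm zify.
Import Order.TTheory GRing.Theory Num.Theory.
Local Open Scope ring_scope.

(** Write [f x y z] for the colour of an edge, as 0 or 1. A copy of the complete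
    tripartite hypergraph on pairs [p u], [q v], [r w] is not a gadget exactly
    when the alternating sum of [f] over its eight edges vanishes
    ([unbalanced_gadget]). If there are few gadgets, this linear equation holds
    for almost all 6-tuples. Solving it with [p], [q], [r] fixed, and averaging
    over their orders, expresses [f] through pairs ([avoid_weight]):
    [6 f(x,y,z) = G(x,y) + G(y,z) + G(x,z)] with an integral weight
    [G = pair_weight p q r].

    For vertices [a], [c] put [h b = G(a,b) - G(c,b)]. Then [h b + h b'] is 6 times
    the difference of two colours, so it is at most 6, and two distinct vertices
    [b], [b'] cannot both have [h > 3]. Hence almost all tuples
    [(p, q, r, a, c, b)] satisfy [h b <= 3] ([card_jump6]); this discards the
    sporadic gadget-free colourings that do not come from a cut but differ from
    one on few edges.

    On a set of vertices where the equation and the bound [h <= 3] hold without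
    exception, the colouring is given by a cut. Among any six such vertices there
    are three, [i], [j], [k], with [G(i,j) = G(j,k) = G(i,k)]
    ([equal_triangle]); this common weight is 0 or 2. Every further vertex [x] is
    then on the side of the triangle or on the other side, according to whether
    [f i j x] equals [f i j k], and a triple [x y z] has the colour of [i j k]
    exactly when its vertices are on one side ([phi_cut]).

    To obtain a single cut for the whole vertex set, consider 12-tuples made of
    [p], [q], [r], six vertices, and a triple [x y z]. All but a small proportion
    have no unbalanced and no exceptional sub-tuple ([card_hits]), so by averaging
    some choice of the first nine entries works for all but a small proportion of
    the triples. The equal triangle depends on these nine entries only, so it
    defines one cut, and the colouring follows that cut on all triples but
    those ([few_rule_breakers], [cut_recolouring]). *)

Set Implicit Arguments.
Unset Strict Implicit.
Unset Printing Implicit Defensive.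

(** * Colourings given by weights on pairs *)

Section EdgeWeights.
Variables (W : eqType) (phi : W -> W -> W -> bool) (G : W -> W -> int).
Hypothesis Gsym : forall x y, G x y = G y x.
Hypothesis phiG : forall x y z, uniq [:: x; y; z] ->
  6 * (phi x y z : nat)%:Z = G x y + G y z + G x z.
Hypothesis Gdiff : forall a b c, uniq [:: a; b; c] -> G a b - G c b <= 3.

Lemma uniq3 (x y z : W) :
  uniq [:: x; y; z] = [&& x != y, x != z & y != z].
Proof. by rewrite /= !inE negb_or andbT andbA. Qed.

Lemma phiG_neq x y z : x != y -> x != z -> y != z ->
  6 * (phi x y z : nat)%:Z = G x y + G y z + G x z.
Proof. by move=> xy xz yz; apply: phiG; rewrite uniq3 xy xz yz. Qed.

Lemma Gnear x y z : x != y -> x != z -> y != z ->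
  - 3 <= G x y - G y z <= 3.
Proof.
move=> xy xz yz; have := @Gdiff x y z; have := @Gdiff z y x; rewrite !uniq3.
rewrite ![z == _]eq_sym ![y == x]eq_sym  xy xz yz => /(_ isT) + /(_ isT).
rewrite (Gsym z y); clear; lia.
Qed.

(** The weights at a vertex [a] lie in a single class modulo 3: writing
    [h x = G x b - G x c], each of [h a + h d], [h a + h e], [h d + h e] is 6
    times a difference of two colours, so [2 * h a] is a multiple of 6; the bound
    [Gdiff] leaves only the differences 0, 3 and -3. *)
Lemma Gstep a b c d e : uniq [:: a; b; c; d; e] ->
  [|| G a b == G a c, G a b == G a c + 3 | G a b == G a c - 3].
Proof.
rewrite /= !inE !negb_or -!andbA.
case/and5P=> ab ac ad ae /and5P[bc bd be cd /and3P[ce de _]].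
have ba : b != a by rewrite eq_sym.
have ca : c != a by rewrite eq_sym.
have := phiG_neq ba bd ad; have := phiG_neq ca cd ad.
have := phiG_neq ba be ae; have := phiG_neq ca ce ae.
have := phiG_neq bd be de; have := phiG_neq cd ce de.
have := Gnear ba bc ac.
rewrite (Gsym b a) (Gsym c a); clear; lia.
Qed.

(** With [v] the common weight, the colour equation makes each of [G b c],
    [G b d], [G c d] equal to [- 2 v] or [6 - 2 v], and being within 3 of [v]
    restricts [v] to the range from -1 to 3 and leaves one choice unless [v = 1].
    For [v = 0] and [v = 2] that choice is [v] itself; for [v = -1] and [v = 3]
    the three weights among [b], [c], [d] agree; [v = 1] admits no colour for
    the triple [b c d]. *)
Lemma three_neighbours a b c d : uniq [:: a; b; c; d] ->
  G a b = G a c -> G a b = G a d ->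
  G a b = G b c \/ G b c = G c d /\ G b c = G b d.
Proof.
rewrite /= !inE !negb_or -!andbA => /and5P[ab ac ad bc /and3P[bd cd _]].
have := phiG_neq ab ac bc; have := phiG_neq ab ad bd.
have := phiG_neq ac ad cd; have := phiG_neq bc bd cd.
have := Gnear ab ac bc; have := Gnear ab ad bd; have := Gnear bc bd cd.
have := Gnear ac ad cd; rewrite eq_sym in bc; have := Gnear bc cd bd.
rewrite (Gsym c b); clear; lia.
Qed.

(** An equal triangle plays the part of three vertices on one side of the cut,
    with inner weight 0 or 2 and crossing weight 3 or -1 according to the colour
    of the triangle. The formula lists the four cases: [x] joins the side of
    [i j k] exactly when [i j x] has the colour of [i j k]. *)
Lemma apex_value i j k x : uniq [:: i; j; k; x] ->
  G i j = G j k -> G i j = G i k ->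
  G i x = 3 * (phi i j x : nat)%:Z - (phi i j k : nat)%:Z /\ G i j = 2 * (phi i j k : nat)%:Z.
Proof.
rewrite /= !inE !negb_or -!andbA => /and5P[ij ik ix jk /and3P[jx kx _]].
have := phiG_neq ij ik jk.
have := phiG_neq ij ix jx; have := phiG_neq ik ix kx.
have := phiG_neq jk jx kx.
have := Gnear ij ix jx; have := Gnear ik ix kx.
have := Gnear jk jx kx.
rewrite eq_sym in jx; rewrite eq_sym in kx.
have := Gnear ix ij jx; have := Gnear ix ik kx.
rewrite (Gsym x j) (Gsym x k); clear; lia.
Qed.

(** The same dichotomy between two outer vertices: their weight is the inner one
    (0 or 2) when they lie on the same side, the crossing one (3 or -1) otherwise. *)
Lemma two_apex_value i j k x y : uniq [:: i; j; k; x; y] ->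
  G i j = G j k -> G i j = G i k ->
  G x y = 3 * (phi i j x != phi i j y : nat)%:Z
   + (phi i j k : nat)%:Z * (2 - 6 * (phi i j x != phi i j y : nat)%:Z).
Proof.
move=> U E1 E2.
have Ux : uniq [:: i; j; k; x].
  by exact: (mask_uniq U [:: true; true; true; true; false]).
have Uy : uniq [:: i; j; k; y].
  by exact: (mask_uniq U [:: true; true; true; false; true]).
have [+ _] := apex_value Ux E1 E2; have [+ _] := apex_value Uy E1 E2.
move: U; rewrite /= !inE !negb_or -!andbA => /and5P[_ _ ix iy /and5P[_ _ _ _ /and3P[_ xy _]]].
have := phiG_neq ix iy xy.
have := Gnear ix iy xy; rewrite eq_sym in xy; have := Gnear iy ix xy.
rewrite (Gsym y x).
case: (phi i j x); case: (phi i j y); case: (phi i j k); rewrite /=; clear; lia.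
Qed.

(** The colouring is read off from the sides: an equal triangle [i j k] serves as
    a fixed reference, and every other triple has the colour of [i j k] exactly
    when its three vertices are on the same side, as measured by [phi i j]. *)
Lemma phi_cut i j k x y z : uniq [:: i; j; k; x; y; z] ->
  G i j = G j k -> G i j = G i k ->
  (phi x y z == phi i j k) =
  ((phi i j x == phi i j y) && (phi i j y == phi i j z)).
Proof.
move=> U E1 E2.
have Uxy : uniq [:: i; j; k; x; y].
  by exact: (mask_uniq U [:: true; true; true; true; true; false]).
have Uxz : uniq [:: i; j; k; x; z].
  by exact: (mask_uniq U [:: true; true; true; true; false; true]).
have Uyz : uniq [:: i; j; k; y; z].
  by exact: (mask_uniq U [:: true; true; true; false; true; true]).
have := two_apex_value Uxy E1 E2; have := two_apex_value Uxz E1 E2.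
have := two_apex_value Uyz E1 E2.
have Uz : uniq [:: x; y; z].
  by move: U; rewrite -[[:: i; _; _; _; _; _]]/([:: i; j; k] ++ _) cat_uniq => /and3P[].
have := phiG Uz.
case: (phi i j x); case: (phi i j y); case: (phi i j z); case: (phi i j k);
  case: (phi x y z); rewrite /=; clear; lia.
Qed.


(** By [Gstep] and [Gdiff] the five weights at [b] take at most two values, so
    three of them agree and [three_neighbours] applies. *)
Lemma equal_triangle b s : uniq (b :: s) -> size s = 5%N ->
  exists i j k, [/\ uniq [:: i; j; k], {subset [:: i; j; k] <= b :: s},
     G i j = G j k & G i j = G i k].
Proof.
move=> us s5.
have from_three a : (2 < size [seq x <- s | a x])%N ->
    {in [seq x <- s | a x] &, forall x y, G b x = G b y} ->
  exists i j k, [/\ uniq [:: i; j; k], {subset [:: i; j; k] <= b :: s},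
     G i j = G j k & G i j = G i k].
  have : subseq (b :: [seq x <- s | a x]) (b :: s) by rewrite /= eqxx filter_subseq.
  case: [seq x <- s | a x] => [|x [|y [|z l]]] // sub _ eqG.
  have sub' : subseq [:: b; x; y; z] (b :: s).
    by apply: subseq_trans sub; apply: (prefix_subseq [:: b; x; y; z] l).
  have ul := subseq_uniq sub' us.
  have e1 : G b x = G b y by apply: eqG; rewrite !inE ?eqxx ?orbT.
  have e2 : G b x = G b z by apply: eqG; rewrite !inE ?eqxx ?orbT.
  have [e|[e3 e4]] := three_neighbours ul e1 e2.
    exists b, x, y; split=> //; first exact: (mask_uniq ul [:: true; true; true; false]).
      by move=> t h; apply: (mem_subseq sub'); apply: (@mem_mask _ t [:: true; true; true; false]).
  exists x, y, z; split=> //; first exact: (mask_uniq ul [:: false; true; true; true]).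
  by move=> t h; apply: (mem_subseq sub'); apply: (@mem_mask _ t [:: false; true; true; true]).
have near x y : x \in s -> y \in s -> 
  [|| G b x == G b y, G b x == G b y + 3 | G b x == G b y - 3].
  have [->|nxy xs ys] := eqVneq x y; first by rewrite eqxx.
  have yr : y \in rem x s by rewrite (mem_rem_uniq x (subseq_uniq (subseq_cons s b) us)) !inE eq_sym nxy.
  have : perm_eq s (x :: y :: rem y (rem x s)).
    by rewrite (permPl (perm_to_rem xs)) perm_cons perm_to_rem.
  move: (rem y (rem x s)) => r.
  move=> ps; move: (perm_size ps) (perm_uniq ps); rewrite s5.
  case: r ps => [|z [|w r]] // ps _.
  have : uniq [:: b, x, y, z, w & r].
    by rewrite -(perm_uniq (_ : perm_eq (b :: s) _)) // perm_cons.
  by move=> /(mask_uniq) /(_ [:: true; true; true; true; true]); rewrite /= mask0s => /Gstep.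
case: s us s5 from_three near => // b1 s us s5 from_three near.
(* Two values other than [G b b1] cannot both occur, since they would differ
   by 6; so one of the two classes below has at least three members. *)
pose P x := G b x == G b b1.
have : (size [seq x <- b1 :: s | P x] + size [seq x <- b1 :: s | ~~ P x] = 5)%N.
  by rewrite !size_filter -s5; exact: count_predC.
have b1in : b1 \in b1 :: s by rewrite inE eqxx.
case: (ltnP 2 (size [seq x <- b1 :: s | P x])) => [h _|h1 h2].
  apply: from_three h _ => x y; rewrite !mem_filter.
  by move=> /andP[/eqP-> _] /andP[/eqP->].
apply: (from_three (fun x => ~~ P x)) => [|x y]; first by lia.
rewrite !mem_filter /P => /andP[xP xs] /andP[yP ys].
move: (near _ _ xs b1in) (near _ _ ys b1in) (near _ _ xs ys) xP yP; clear; lia.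
Qed.
End EdgeWeights.

Local Open Scope nat_scope.

(** * Counting tuples *)

Lemma card_le_fibres (A B : finType) (S : {set A}) (S' : {set B}) (h : A -> B) c :
  (forall x, x \in S -> h x \in S') ->
  (forall x, x \in S -> #|[set y in S | h y == h x]| <= c) ->
  #|S| <= c * #|S'|.
Proof.
move=> hS hc; rewrite -sum1_card (partition_big h (mem S')) //=.
rewrite mulnC -sum_nat_const; apply: leq_sum => y _.
rewrite sum1dep_card; have [->|[x]] := set_0Vmem [set z in S | h z == y].
  by rewrite cards0.
by rewrite inE => /andP[xS /eqP <-]; apply: hc.
Qed.

Definition restr (K I : finType) (T : finType) (t : {ffun I -> T}) (s : {ffun K -> I}) :
  {ffun K -> T} := [ffun k => t (s k)].

(** A tuple with prescribed entries at the positions [s] is determined by its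
    entries at the remaining positions. *)
Lemma card_restr_fibre (K I T : finType) (s : {ffun K -> I}) (r : {ffun K -> T}) :
  injective s -> #|[set t | restr t s == r]| <= #|T| ^ (#|I| - #|K|).
Proof.
move=> injs.
pose J := {i | i \notin codom s}.
have -> : #|T| ^ (#|I| - #|K|) = #|{ffun J -> T}|.
  by rewrite card_ffun card_sig -(card_codom injs) -(cardC (mem (codom s))) addKn.
rewrite -(card_in_imset (f := fun t : {ffun I -> T} => [ffun i : J => t (val i)])).
  exact: max_card.
move=> t t'; rewrite !inE => /eqP tr /eqP t'r /ffunP eqt; apply/ffunP => i.
have [/codomP[k ->]|iJ] := boolP (i \in codom s).
  by move/ffunP: tr => /(_ k); move/ffunP: t'r => /(_ k); rewrite !ffunE => -> ->.
by have := eqt (exist _ i iJ); rewrite !ffunE.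
Qed.

Lemma leq_card_exists (A B : finType) (P : A -> B -> bool) c :
  (forall b, #|[set a | P a b]| <= c) -> #|[set a | [exists b, P a b]]| <= #|B| * c.
Proof.
move=> hc.
apply: (@leq_trans #|[set ab : A * B | P ab.1 ab.2]|).
  have -> : [set a | [exists b, P a b]] = [set ab.1 | ab in [set ab : A * B | P ab.1 ab.2]].
    apply/setP=> a; rewrite inE; apply/existsP/imsetP => [[b Pab]|[[a' b] + ->]].
      by exists (a, b); rewrite ?inE.
    by rewrite inE; exists b.
  exact: leq_imset_card.
rewrite mulnC -[#|B|]cardsT; apply: (@card_le_fibres _ _ _ _ snd) => // -[a b] _ /=.
apply: leq_trans (hc b); rewrite -(card_imset _ (f := fun a' => (a', b))); last by move=> ? ? [].
apply: subset_leq_card; apply/subsetP => -[a' b']; rewrite !inE /= => /andP[h /eqP E].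
by subst b'; apply: imset_f; rewrite inE.
Qed.

(** With [e] the size of a fibre of [h], this is [M e n <= n ^ 2 + (M e) ^ 2]
    summed over the fibres; it replaces the Cauchy-Schwarz inequality and avoids
    square roots, the parameter [M] being chosen at the end. *)
Lemma pair_count (A B : finType) (S : {set A}) (h : A -> B) n M :
  M * n * #|S| <= n ^ 2 * #|B| + M ^ 2 * #|[set xy in setX S S | h xy.1 == h xy.2]|.
Proof.
pose e b := #|[set x in S | h x == b]|.
have -> : #|S| = \sum_b e b.
  rewrite -sum1_card (partition_big h predT) //=; apply: eq_bigr => b _.
  by rewrite sum1dep_card.
have -> : #|[set xy in setX S S | h xy.1 == h xy.2]| = \sum_b e b ^ 2.
  rewrite -sum1_card (partition_big (h \o fst) predT) //=; apply: eq_bigr => b _.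
  rewrite sum1dep_card -mulnn -cardsX; apply: eq_card => -[x y]; rewrite !inE /=.
  have [->|_] := eqVneq (h x) b; rewrite ?andbF //=.
  by rewrite !andbT (eq_sym b) -andbA.
rewrite -[#|B|]sum1_card !big_distrr -big_split /=; apply: leq_sum => b _.
rewrite muln1 -expnMn mulnAC mulnC; apply: leq_trans (nat_Cauchy _ _).
by rewrite leq_pmull.
Qed.

(** There are at most [k.+1 ^ 2] pairs of positions, and an entry repeated at a
    given pair can be dropped. *)
Lemma card_noninj k (T : finType) :
  #|[set t : {ffun 'I_k.+1 -> T} | ~~ injectiveb t]| <= k.+1 ^ 2 * #|T| ^ k.
Proof.
have E (ij : 'I_k.+1 * 'I_k.+1) :
   #|[set t : {ffun 'I_k.+1 -> T} | (ij.1 != ij.2) && (t ij.1 == t ij.2)]| <= #|T| ^ k.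
  case: ij => i j /=.
  have -> : #|T| ^ k = #|T| ^ k * #|[set tt]| by rewrite cards1 muln1.
  have -> : #|T| ^ k = #|{ffun 'I_k -> T}| by rewrite card_ffun card_ord.
  rewrite cards1 muln1 -(card_in_imset (f := fun t : {ffun 'I_k.+1 -> T} => [ffun l => t (lift j l)])).
    exact: max_card.
  move=> t t'; rewrite !inE => /andP[ij /eqP e] /andP[_ /eqP e'] /ffunP eqt.
  have H l : t (lift j l) = t' (lift j l) by move: (eqt l); rewrite !ffunE.
  apply/ffunP => l; have [m ->|->] := unliftP j l => //.
  rewrite eq_sym in ij; have [m em _] := unlift_some ij.
  by rewrite -e -e' em.
have := leq_card_exists E; rewrite card_prod card_ord mulnn; apply: leq_trans.
apply: subset_leq_card; apply/subsetP => t; rewrite !inE => /injectivePn[x [y nxy exy]].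
by apply/existsP; exists (x, y); rewrite /= nxy exy eqxx.
Qed.

(** The tuples that have a sub-tuple in [S] at distinct positions. *)
Definition hits (I K T : finType) (S : {set {ffun K -> T}}) : {set {ffun I -> T}} :=
  [set t | [exists s : {ffun K -> I}, injectiveb s && (restr t s \in S)]].

Lemma card_hits (I K T : finType) (S : {set {ffun K -> T}}) :
  #|hits I S| <= #|I| ^ #|K| * (#|T| ^ (#|I| - #|K|) * #|S|).
Proof.
rewrite -card_ffun; apply: leq_card_exists => s.
have [/injectiveP injs|_] := boolP (injectiveb s); last first.
  by rewrite (_ : [set _ | _] = set0) ?cards0 //; apply/setP => t; rewrite !inE.
rewrite /=; apply: (@card_le_fibres _ _ _ _ (fun t => restr t s)) => [t|t _].
  by rewrite inE.
apply: leq_trans (card_restr_fibre (restr t s) injs).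
by apply/subset_leq_card/subsetP => t'; rewrite !inE => /andP[].
Qed.

Lemma exists_small_fibre (A B : finType) (P : A -> B -> bool) K : 0 < #|A| ->
  K * #|[set ab : A * B | P ab.1 ab.2]| <= #|A| * #|B| ->
  exists a, K * #|[set b | P a b]| <= #|B|.
Proof.
move=> A0 h; apply/existsP; apply: contraLR h; rewrite negb_exists -ltnNge => /forallP h.
have -> : #|[set ab : A * B | P ab.1 ab.2]| = \sum_a #|[set b | P a b]|.
  rewrite -sum1_card (eq_bigl (fun ab => true && P ab.1 ab.2)); last by move=> ?; rewrite inE.
  rewrite -(pair_big_dep predT P (fun _ _ => 1)) /=; apply: eq_bigr => a _.
  by rewrite sum1dep_card.
rewrite big_distrr /= -sum1_card big_distrl /=.
have [a _] := card_gt0P A0.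
rewrite (bigD1 a) // [ltnRHS](bigD1 a) //= -addSn leq_add //.
  by move: (h a); rewrite -ltnNge mul1n.
by apply: leq_sum => b _; move: (h b); rewrite -ltnNge mul1n => /ltnW.
Qed.

(** * Unbalanced tuples and gadgets *)

Section Gadgets.
Variables (n : nat) (col : colouring n).

(** Colours extended by [false] to sets that are not edges, so that sums over
    arbitrary families of sets make sense. *)
Definition set_colour (A : {set 'I_n}) : bool :=
  if insub A is Some e then col e else false.

Definition colour3 (x y z : 'I_n) : bool := set_colour [set x; y; z].

(** The number of edges of colour [true] in the image of [Pasch] under [s], and
    below in the image of the complementary Pasch configuration. The pairs 12,
    34, 56 are the parts, and a triple is even when it takes an even number of
    second elements. *)
Definition even_sum (s : 'I_6 -> 'I_n) : nat :=
  let t i j k := colour3 (s (vtx i)) (s (vtx j)) (s (vtx k)) : nat in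
  t 1 3 5 + t 1 4 6 + t 2 3 6 + t 2 4 5.

Definition odd_sum (s : 'I_6 -> 'I_n) : nat :=
  let t i j k := colour3 (s (vtx i)) (s (vtx j)) (s (vtx k)) : nat in
  t 1 3 6 + t 1 4 5 + t 2 3 5 + t 2 4 6.

Definition copasch : {set {set 'I_6}} :=
  [set triple 1 3 6; triple 1 4 5; triple 2 3 5; triple 2 4 6].

Lemma vtxE k l : 0 < k <= 6 -> 0 < l <= 6 -> (vtx k == vtx l) = (k == l).
Proof.
move=> /andP[k0 k6] /andP[l0 l6].
by rewrite -val_eqE /= !inordK ?prednK //; lia.
Qed.

Lemma forall_vtx (P : 'I_6 -> Prop) :
  P (vtx 1) -> P (vtx 2) -> P (vtx 3) -> P (vtx 4) -> P (vtx 5) -> P (vtx 6) ->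
  forall i, P i.
Proof.
move=> p1 p2 p3 p4 p5 p6 i.
have -> : i = vtx i.+1 by apply: val_inj; rewrite /= inordK /=.
by case: i => [[|[|[|[|[|[|m]]]]]] lti] //=; move: lti; rewrite !ltnS.
Qed.

(** Equality of subsets of ['I_6] turned into six boolean tests, which makes the
    finite identities below decidable by case analysis. *)
Lemma set6_eqE (A B : {set 'I_6}) :
  (A == B) = [&& (vtx 1 \in A) == (vtx 1 \in B), (vtx 2 \in A) == (vtx 2 \in B),
   (vtx 3 \in A) == (vtx 3 \in B), (vtx 4 \in A) == (vtx 4 \in B),
   (vtx 5 \in A) == (vtx 5 \in B) & (vtx 6 \in A) == (vtx 6 \in B)].
Proof.
apply/eqP/and5P => [->|[/eqP e1 /eqP e2 /eqP e3 /eqP e4 /andP[/eqP e5 /eqP e6]]].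
  by rewrite !eqxx.
by apply/setP; apply: forall_vtx.
Qed.

Lemma in_triple l i j k : 0 < l <= 6 -> 0 < i <= 6 -> 0 < j <= 6 -> 0 < k <= 6 ->
  (vtx l \in triple i j k) = [|| l == i, l == j | l == k].
Proof. by move=> ? ? ? ?; rewrite !inE !vtxE ?orbA. Qed.

Lemma card_setI_pair (e : {set 'I_6}) k l : 0 < k <= 6 -> 0 < l <= 6 -> k != l ->
  #|e :&: [set vtx k; vtx l]| = (vtx k \in e) + (vtx l \in e).
Proof.
move=> hk hl kl; rewrite setIUr cardsU.
have -> : e :&: [set vtx k] :&: (e :&: [set vtx l]) = set0.
  apply/setP => x; rewrite !inE; case: eqP => [->|]; rewrite ?andbF //.
  by rewrite vtxE // (negbTE kl) !andbF.
have card1 x : #|e :&: [set x]| = (x \in e).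
  have [xe|xe] := boolP (x \in e); first by rewrite (setIidPr _) ?sub1set ?cards1.
  by apply/eqP; rewrite cards_eq0 setI_eq0 disjoint_sym disjoints1.
by rewrite cards0 subn0 !card1.
Qed.

Lemma K222_decomposition : Pasch :|: copasch = K222.
Proof.
apply/setP => e; rewrite !inE !set6_eqE !card_setI_pair // !in_triple //=.
by do 6 case: (_ \in e).
Qed.

Lemma disjoint_Pasch : [disjoint Pasch & copasch].
Proof.
rewrite disjoint_subset; apply/subsetP => e; rewrite !inE !set6_eqE !in_triple //=.
by do 6 case: (_ \in e).
Qed.

(** Exchanging the two vertices of one part reverses the parity of every triple. *)
Lemma copasch_copy : copasch = [set tperm (vtx 5) (vtx 6) @: e | e : {set 'I_6} in Pasch].
Proof.
by rewrite /Pasch /copasch !imsetU !imset_set1 /triple !imsetU !imset_set1 tpermL tpermR !tpermD ?vtxE.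
Qed.

Lemma sum_Pasch (F : {set 'I_6} -> nat) : 
  \sum_(e in Pasch) F e = F (triple 1 3 5) + F (triple 1 4 6) + F (triple 2 3 6) + F (triple 2 4 5).
Proof.
rewrite /Pasch -!setUA !big_setU1 ?big_set1 /=; first by rewrite !addnA.
all: by rewrite !inE ?negb_or !set6_eqE !in_triple.
Qed.

Lemma sum_copasch (F : {set 'I_6} -> nat) : 
  \sum_(e in copasch) F e = F (triple 1 3 6) + F (triple 1 4 5) + F (triple 2 3 5) + F (triple 2 4 6).
Proof.
rewrite /copasch -!setUA !big_setU1 ?big_set1 /=; first by rewrite !addnA.
all: by rewrite !inE ?negb_or !set6_eqE !in_triple.
Qed.

Definition copy (s : 'I_6 -> 'I_n) (H : {set {set 'I_6}}) := [set s @: e | e : {set 'I_6} in H].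

Lemma num_coloured_copy (s : 'I_6 -> 'I_n) (H : {set {set 'I_6}}) : injective s ->
  num_coloured col true (copy s H) =
  \sum_(e in H) set_colour (s @: e).
Proof.
move=> injs; rewrite /num_coloured.
rewrite -(big_imset (h := fun e : {set 'I_6} => s @: e) (fun A => set_colour A : nat)) /=;
  last by move=> ? ? _ _; apply: imset_inj.
rewrite -/(copy s H) (bigID set_colour) /= [X in _ = _ + X]big1 ?addn0;
  last by move=> A /andP[_ /negbTE ->].
rewrite (eq_bigr (fun=> 1)); last by move=> A /andP[_ ->].
rewrite sum1dep_card -(card_imset _ (val_inj : injective (val : edge n -> _))).
apply: eq_card => A; rewrite !inE; apply/imsetP/andP => [[e + ->]|[AH]].
  by rewrite !inE /set_colour valK => /andP[-> /eqP ->].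
rewrite /set_colour; case: insubP => // e _ eA ce; exists e => //.
by rewrite !inE eA AH ce.
Qed.

(** The two Pasch configurations that decompose the image of [K222] then have
    different numbers of edges of colour [true]. *)
Lemma unbalanced_gadget (s : {ffun 'I_6 -> 'I_n}) :
  injective s -> even_sum s != odd_sum s -> copy s K222 \in gadgets col.
Proof.
move=> injs neq; rewrite inE /is_gadget; apply/andP; split.
  by apply/existsP; exists s; rewrite eqxx andbT; apply/injectiveP.
apply/existsP; exists (copy s Pasch); apply/existsP; exists (copy s copasch).
apply/and5P; split.
- by apply/existsP; exists s; rewrite eqxx andbT; apply/injectiveP.
- apply/existsP; exists [ffun i => s (tperm (vtx 5) (vtx 6) i)]; apply/andP; split.
    by apply/injectiveP => i j; rewrite !ffunE => /injs/perm_inj.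
  rewrite /copy copasch_copy -imset_comp; apply/eqP/eq_imset => e /=.
  by rewrite -imset_comp; apply: eq_imset => i; rewrite /= ffunE.
- by rewrite /copy imset_disjoint ?disjoint_Pasch //; apply: imset_inj.
- by rewrite /copy -imsetU K222_decomposition.
apply/existsP; exists true; rewrite !num_coloured_copy // sum_Pasch sum_copasch.
by rewrite /triple !imsetU !imset_set1.
Qed.

End Gadgets.

(** * Bounds for unbalanced and exceptional tuples *)

Section Tuples.
Variables (n : nat) (col : colouring n).
Notation T := 'I_n.
Notation colour3 := (colour3 col).

Lemma colour3C x y z : colour3 x y z = colour3 y x z.
Proof. by rewrite /colour3; congr set_colour; rewrite (setUC [set x]). Qed.

Lemma colour3CA x y z : colour3 x y z = colour3 x z y.
Proof. by rewrite /colour3 -setUA (setUC [set y]) setUA. Qed.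

(** The symmetrisation over the orders of [p], [q], [r] of the solution of the
    linear equation [even_sum = odd_sum], scaled by 6 to be integral. *)
Definition pair_weight (p q r x y : T) : int := 
  (2 * (colour3 p x y + colour3 q x y + colour3 r x y)%N%:Z
  - (colour3 p q x + colour3 p r x + colour3 q r x + colour3 p q y + colour3 p r y + colour3 q r y)%N%:Z
  + 2 * (colour3 p q r : nat)%:Z)%R.

Definition unbalanced6 : {set {ffun 'I_6 -> T}} :=
  [set s : {ffun 'I_6 -> T} | ~~ injectiveb s || (even_sum col s != odd_sum col s)].

(** The exceptional tuples [(p, q, r, a, c, b)]. In a colouring given by a cut,
    two weights at a common vertex [b] differ by 0 or 3; a larger difference
    does occur in colourings without gadgets, for instance when only the edges
    through two fixed vertices have colour [true], but only for few tuples. *)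
Definition jump6 : {set {ffun 'I_6 -> T}} :=
  [set s : {ffun 'I_6 -> T} | let g := pair_weight (s (vtx 1)) (s (vtx 2)) (s (vtx 3)) in
    (3 < g (s (vtx 4)) (s (vtx 6)) - g (s (vtx 5)) (s (vtx 6)))%R].

(** An injective unbalanced 6-tuple spans a gadget, and a gadget arises from at
    most [6 ^ 6] tuples since their entries lie in its 6 vertices. *)
Lemma card_unbalanced6 : #|unbalanced6| <= 6 ^ 6 * #|gadgets col| + 6 ^ 2 * n ^ 5.
Proof.
pose S := [set s : {ffun 'I_6 -> T} | injectiveb s & even_sum col s != odd_sum col s].
have -> : unbalanced6 = S :|: [set s : {ffun 'I_6 -> T} | ~~ injectiveb s].
  by apply/setP => s; rewrite !inE; case: (injectiveb s); rewrite ?orbF ?orbT.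
apply: leq_trans (leq_card_setU _ _) _; apply: leq_add; last first.
  by have := card_noninj 5 T; rewrite card_ord.
apply: (@card_le_fibres _ _ _ _ (fun s : {ffun 'I_6 -> T} => copy s K222)) => [s|s _].
  by rewrite inE => /andP[/injectiveP injs neq]; apply: unbalanced_gadget.
have cover_copy (r : {ffun 'I_6 -> T}) : cover (copy r K222) = r @: setT.
  apply/setP => x; apply/bigcupP/imsetP => [[_ /imsetP[e _ ->] /imsetP[i _ ->]]|[i _ ->]].
    by exists i.
  have [e eK ie] : exists2 e, e \in K222 & i \in e.
    rewrite -K222_decomposition.
    have [T1 T2 T3] : [/\ triple 1 3 5 \in Pasch, triple 2 4 5 \in Pasch & triple 1 4 6 \in Pasch].
      by rewrite !inE !eqxx ?orbT.
    move: i; apply: forall_vtx;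
    [exists (triple 1 3 5) | exists (triple 2 4 5) | exists (triple 1 3 5)
      | exists (triple 2 4 5) | exists (triple 1 3 5) | exists (triple 1 4 6)];
    by rewrite ?in_triple // in_setU ?T1 ?T2 ?T3.
  by exists (r @: e); apply: imset_f.
apply: (@leq_trans #|ffun_on (mem (cover (copy s K222))) : {pred {ffun 'I_6 -> T}}|).
  apply/subset_leq_card/subsetP => r; rewrite !inE => /andP[_ /eqP e].
  by apply/ffun_onP => i; rewrite -e cover_copy imset_f.
rewrite card_ffun_on card_ord leq_exp2r //.
by rewrite cover_copy; apply: leq_trans (leq_imset_card _ _) _; rewrite cardsT card_ord.
Qed.

Section Avoid.
Variables (I : finType) (t : {ffun I -> T}).

Lemma hexad i1 i2 i3 i4 i5 i6 : uniq [:: i1; i2; i3; i4; i5; i6] ->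
  exists s : {ffun 'I_6 -> I}, [/\ injective s,
    [/\ s (vtx 1) = i1, s (vtx 2) = i2 & s (vtx 3) = i3]
    & [/\ s (vtx 4) = i4, s (vtx 5) = i5 & s (vtx 6) = i6]].
Proof.
move=> U; exists [ffun k : 'I_6 => nth i1 [:: i1; i2; i3; i4; i5; i6] k].
split; try by split; rewrite ffunE inordK.
by move=> k l; rewrite !ffunE => /eqP; rewrite nth_uniq // => /eqP/val_inj.
Qed.

Lemma avoid_balanced p u q v r w : t \notin hits I unbalanced6 ->
  uniq [:: p; u; q; v; r; w] ->
  (colour3 (t p) (t q) (t r) + colour3 (t p) (t v) (t w) + colour3 (t q) (t u) (t w) + colour3 (t r) (t u) (t v) = 
  colour3 (t p) (t q) (t w) + colour3 (t p) (t r) (t v) + colour3 (t q) (t r) (t u) + colour3 (t u) (t v) (t w)).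
Proof.
move=> avoid /hexad[s [injs [s1 s2 s3] [s4 s5 s6]]].
move: avoid; rewrite inE negb_exists => /forallP /(_ s).
rewrite (introT (injectiveP _) injs) inE negb_or !negbK => /andP[_ /eqP].
rewrite /even_sum /odd_sum !ffunE s1 s2 s3 s4 s5 s6.
rewrite (colour3C (t u) (t q) (t w)) (colour3CA (t u) (t v) (t r)) (colour3C (t u) (t r) (t v)).
by rewrite (colour3CA (t p) (t v) (t r)) (colour3C (t u) (t q) (t r)) (colour3CA (t q) (t u) (t r)).
Qed.

(** Solving the balance equation for the colour of [x y z] and adding the results
    over the six orders of [p], [q], [r]. *)
Lemma avoid_weight p q r x y z : t \notin hits I unbalanced6 ->
  uniq [:: p; q; r; x; y; z] ->
  let g i j := pair_weight (t p) (t q) (t r) (t i) (t j) in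
  (6 * (colour3 (t x) (t y) (t z) : nat)%:Z = g x y + g y z + g x z)%R.
Proof.
move=> avoid U.
have B p' q' r' : perm_eq [:: p'; q'; r'] [:: p; q; r] ->
  (colour3 (t p') (t q') (t r') + colour3 (t p') (t y) (t z) + colour3 (t q') (t x) (t z) + colour3 (t r') (t x) (t y) = 
  colour3 (t p') (t q') (t z) + colour3 (t p') (t r') (t y) + colour3 (t q') (t r') (t x) + colour3 (t x) (t y) (t z)).
  move=> pe; apply: avoid_balanced => //.
  rewrite -(perm_uniq (_ : perm_eq ([:: p; q; r] ++ [:: x; y; z]) _)) //.
  rewrite perm_sym in pe; rewrite (permPl (perm_cat pe (perm_refl _))).
  by rewrite /= perm_cons (perm_catCA [:: q'; r'] [:: x]) perm_cons /= perm_cons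
    (perm_catCA [:: r'] [:: y]) /= !perm_cons.
have perm3 (a b c : I) : [/\ perm_eq [:: b; a; c] [:: a; b; c] & perm_eq [:: a; c; b] [:: a; b; c]].
  by split; rewrite ?perm_cons; apply/seq.permP => ? /=; lia.
have := B _ _ _ (perm_refl _).
have [pe1 pe2] := perm3 p q r.
have := B _ _ _ pe1; have := B _ _ _ pe2.
have [pe3 pe4] := perm3 q p r; have := B _ _ _ (perm_trans pe4 pe1).
have [pe5 pe6] := perm3 p r q; have := B _ _ _ (perm_trans pe5 pe2).
have [pe7 pe8] := perm3 r p q; have := B _ _ _ (perm_trans pe8 (perm_trans pe5 pe2)).
move=> {B pe1 pe2 pe3 pe4 pe5 pe6 pe7 pe8 perm3 U avoid}.
rewrite !(colour3C (t q) (t p)) !(colour3C (t r) (t p)) !(colour3C (t r) (t q)).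
rewrite !(colour3CA (t p) (t r) (t q)) !(colour3CA (t q) (t r) (t p)) (colour3C (t q) (t p)) /pair_weight.
repeat match goal with |- context [nat_of_bool ?b] => move: (nat_of_bool b) => ? end.
lia.
Qed.

Lemma pair_weightC p q r x y : pair_weight p q r x y = pair_weight p q r y x.
Proof.
rewrite /pair_weight !(colour3CA _ x y).
repeat match goal with |- context [nat_of_bool ?b] => move: (nat_of_bool b) => ? end.
lia.
Qed.

Lemma avoid_jump p q r a c b : t \notin hits I jump6 -> uniq [:: p; q; r; a; c; b] ->
  let g i j := pair_weight (t p) (t q) (t r) (t i) (t j) in
  (g a b - g c b <= 3)%R.
Proof.
move=> avoid /hexad[s [injs [s1 s2 s3] [s4 s5 s6]]] /=.
move: avoid; rewrite inE negb_exists => /forallP /(_ s).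
rewrite (introT (injectiveP _) injs) inE /= !ffunE s1 s2 s3 s4 s5 s6.
by rewrite -leNgt.
Qed.

End Avoid.

(** If [b] and [b'] are both exceptional for [(p, q, r, a, c)], the differences
    of weights at [b] and [b'] add up to more than 6, whereas [avoid_weight] makes
    this sum 6 times the difference of the colours of [a b b'] and [c b b']. *)
Lemma hits_unbalanced_of_jumps (s s' : {ffun 'I_6 -> T}) :
  s \in jump6 -> s' \in jump6 -> (forall k, k != vtx 6 -> s k = s' k) ->
  [ffun o : option 'I_6 => if o is Some k then s k else s' (vtx 6)] \in hits (option 'I_6) unbalanced6.
Proof.
move=> js js' eqs; apply/contraT; set t := finfun _ => avoid.
have tS k : t (Some k) = s k by rewrite ffunE.
have tN : t None = s' (vtx 6) by rewrite ffunE.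
pose o k := Some (vtx k).
have W k : 0 < k <= 6 -> k \notin [:: 1; 2; 3; 6] -> 
    uniq [:: o 1; o 2; o 3; o k; o 6; None].
  move=> hk; rewrite /= !inE !(inj_eq (@Some_inj _)) !vtxE // !negb_or -!andbA.
  rewrite !(eq_sym k); do 3 case/andP=> /negbTE-> ; by move/negbTE; rewrite eq_sym => ->.
have := avoid_weight avoid (W 4 isT isT); have := avoid_weight avoid (W 5 isT isT).
rewrite /o !tS tN.
move: js; rewrite inE /=; move: js'; rewrite inE /=.
rewrite -(eqs (vtx 1)) -?(eqs (vtx 2)) -?(eqs (vtx 3)) -?(eqs (vtx 4)) -?(eqs (vtx 5)) ?vtxE //.
move: (pair_weight _ _ _) => g.
lia.
Qed.

(** Two exceptional tuples with the same first five entries give a 7-tuple with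
    an unbalanced sub-tuple, so [pair_count] bounds the exceptional tuples by the
    unbalanced ones, up to a term [n ^ 6 / M]. *)
Lemma card_jump6 M : M * #|jump6| <= n ^ 6 + M ^ 2 * (7 ^ 6 * #|unbalanced6|).
Proof.
have [n0|n0] := posnP n.
  have : #|jump6| <= 0 by apply: leq_trans (max_card _) _; rewrite card_ffun !card_ord [X in X ^ _]n0.
  by rewrite leqn0 => /eqP ->; rewrite muln0.
pose head (s : {ffun 'I_6 -> T}) : {ffun 'I_5 -> T} := [ffun k => s (lift (vtx 6) k)].
have := pair_count jump6 head n M; rewrite card_ffun !card_ord.
set P := [set _ in setX _ _ | _].
pose glue (xy : {ffun 'I_6 -> T} * {ffun 'I_6 -> T}) : {ffun option 'I_6 -> T} :=
  [ffun o => if o is Some k then xy.1 k else xy.2 (vtx 6)].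
have agree s s' : (s, s') \in P -> forall k, k != vtx 6 -> s k = s' k.
  rewrite inE => /andP[_ /eqP/ffunP e] k; rewrite eq_sym => /unlift_some[l -> _].
  by have := e l; rewrite !ffunE.
have : #|P| <= 7 ^ 6 * (n * #|unbalanced6|).
  rewrite -(card_in_imset (f := glue)); last first.
    move=> [s s'] [r r'] sP rP /ffunP e.
    have e1 k : s k = r k by have := e (Some k); rewrite !ffunE.
    have e2 : s' (vtx 6) = r' (vtx 6) by have := e None; rewrite !ffunE.
    congr pair; apply/ffunP => k //.
    have [->//|k6] := eqVneq k (vtx 6).
    by rewrite -(agree _ _ sP) // -(agree _ _ rP).
  have := @card_hits (option 'I_6) 'I_6 T unbalanced6.
  rewrite card_option !card_ord subSnn expn1; apply: leq_trans.
  apply/subset_leq_card/subsetP => _ /imsetP[[s s'] sP ->].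
  move: (sP); rewrite inE in_setX => /andP[/andP[js js'] _].
  exact: hits_unbalanced_of_jumps (agree _ _ sP).
move: (7 ^ 6) (#|P|) (#|unbalanced6|) (#|jump6|) => c a b d h1 h2.
rewrite -(leq_pmul2l n0); apply: leq_trans (_ : _ <= n ^ 2 * n ^ 5 + M ^ 2 * a) _.
  by rewrite mulnA (mulnC n).
rewrite -expnD mulnDr -expnS leq_add2l mulnCA leq_mul2l; apply/orP; right.
by rewrite mulnCA.
Qed.
End Tuples.

(** * From local cuts to one cut *)

Section Cut.
Variables (n : nat) (col : colouring n).
Notation T := 'I_n.
Notation colour3 := (colour3 col).
Notation I12 := ('I_3 + ('I_6 + 'I_3))%type.
Notation S := (unbalanced6 col :|: jump6 col).

Lemma hitsU (I : finType) (t : {ffun I -> T}) :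
  t \notin hits I S -> t \notin hits I (unbalanced6 col) /\ t \notin hits I (jump6 col).
Proof.
rewrite ![t \in _]inE => /existsPn h; split; apply/existsPn => s;
  by apply: contraNN (h s) => /andP[-> /=]; rewrite in_setU => ->; rewrite ?orbT.
Qed.

(** A 12-tuple split into the parameters [p], [q], [r] of the weights, six
    vertices that will contain an equal triangle, and the triple to be coloured. *)
Definition glue (u : {ffun 'I_3 -> T} * {ffun 'I_6 -> T}) (v : {ffun 'I_3 -> T}) :
    {ffun I12 -> T} :=
  [ffun a => match a with inl l => u.1 l | inr (inl l) => u.2 l | inr (inr l) => v l end].

Definition o3 k : 'I_3 := inord k.

Definition cut_rule (i j : T) (c : bool) (v : 'I_3 -> T) : bool :=
  (colour3 (v (o3 0)) (v (o3 1)) (v (o3 2)) == c) ==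
  ((colour3 i j (v (o3 0)) == colour3 i j (v (o3 1))) &&
   (colour3 i j (v (o3 1)) == colour3 i j (v (o3 2)))).

(** The equal triangle found among the six middle entries depends only on the
    weights there, hence on [u]; so one and the same triangle describes the
    colours of [v] for every [v] that makes the glued tuple good. *)
Lemma glue_cut u v0 : glue u v0 \notin hits I12 S ->
  exists i j c, forall v, glue u v \notin hits I12 S -> cut_rule i j c v.
Proof.
pose J : finType := ('I_6 + 'I_3)%type.
pose f v (a b c : J) := colour3 (glue u v (inr a)) (glue u v (inr b)) (glue u v (inr c)).
pose g v (a b : J) :=
  pair_weight col (u.1 (o3 0)) (u.1 (o3 1)) (u.1 (o3 2)) (glue u v (inr a)) (glue u v (inr b)).
have gluel v k : glue u v (inl k) = u.1 k by rewrite ffunE.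
have uniq_o : uniq [:: o3 0; o3 1; o3 2] by rewrite /= !inE -!val_eqE /= !inordK.
have uniq6 (a b c : J) : uniq [:: a; b; c] ->
    uniq [:: inl (o3 0); inl (o3 1); inl (o3 2); inr a; inr b; inr c : I12].
  move=> U; rewrite -[X in uniq X]/([seq inl k | k <- [:: o3 0; o3 1; o3 2]] ++ [seq inr k | k <- [:: a; b; c]]).
  rewrite cat_uniq !map_inj_uniq ?uniq_o ?U //=; try by move=> ? ? [].
have gC v a b : g v a b = g v b a by apply: pair_weightC.
have fg v : glue u v \notin hits I12 S -> forall a b c, uniq [:: a; b; c] ->
    (6 * (f v a b c : nat)%:Z = g v a b + g v b c + g v a c)%R.
  move=> /hitsU[avoid _] a b c /uniq6 U.
  by have := avoid_weight avoid U; rewrite !gluel.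
have jump v : glue u v \notin hits I12 S -> forall a b c, uniq [:: a; b; c] ->
    (g v a b - g v c b <= 3)%R.
  move=> /hitsU[_ avoid] a b c U.
  have := @avoid_jump _ _ _ _ (inl (o3 0)) (inl (o3 1)) (inl (o3 2)) (inr a) (inr c) (inr b) avoid.
  rewrite !gluel; apply; apply: uniq6.
  by move: U; rewrite /= !inE !negb_or (eq_sym b c) => /and3P[/andP[-> ->] -> _].
move=> good0.
pose b k : 'I_6 := inord k.
have [] := @equal_triangle J (f v0) (g v0) (gC v0) (fg v0 good0) (jump v0 good0)
  (inl (b 0)) [seq inl (b k) | k <- [:: 1; 2; 3; 4; 5]].
- rewrite -[X in uniq X]/([seq (inl (b k) : J) | k <- [:: 0; 1; 2; 3; 4; 5]]).
  rewrite map_inj_in_uniq // => k l kl ll [] /(congr1 val) /=.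
  have lt6 m : m \in [:: 0; 1; 2; 3; 4; 5] -> m < 6 by rewrite !inE; lia.
  by rewrite !inordK ?lt6.
- by [].
move=> i' [j' [k' [U sub e1 e2]]].
have inl_of a : a \in [:: i'; j'; k'] -> exists l, a = inl l.
  by move=> /sub; rewrite -[X in a \in X]/([seq (inl (b k) : J) | k <- [:: 0; 1; 2; 3; 4; 5]]) => /mapP[k _ ->]; exists (b k).
have [i ei] : exists l, i' = inl l by apply: inl_of; rewrite !inE eqxx.
have [j ej] : exists l, j' = inl l by apply: inl_of; rewrite !inE eqxx ?orbT.
have [k ek] : exists l, k' = inl l by apply: inl_of; rewrite !inE eqxx ?orbT.
subst i' j' k'.
exists (u.2 i), (u.2 j), (colour3 (u.2 i) (u.2 j) (u.2 k)) => v good.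
have U6 : uniq [:: inl i; inl j; inl k; inr (o3 0); inr (o3 1); inr (o3 2) : J].
  rewrite -[X in uniq X]/([seq inl l | l <- [:: i; j; k]] ++ [seq inr l | l <- [:: o3 0; o3 1; o3 2]]).
  rewrite cat_uniq -[X in uniq X]/[:: inl i; inl j; inl k : J] U (map_inj_uniq (f := inr)) ?uniq_o //.
  by move=> ? ? [].
have := phi_cut (gC v) (fg v good) (jump v good) U6.
move: e1 e2; rewrite /g /f !ffunE /= => e1 e2 /(_ e1 e2) h.
by apply/eqP.
Qed.

(** By averaging, some [u] completes to a bad 12-tuple for at most [n ^ 3 / K]
    triples; as [1 < K], it also completes to a good one, which [glue_cut] needs. *)
Lemma few_rule_breakers K : 1 < K -> 0 < n -> K * #|hits I12 S| <= n ^ 12 ->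
  exists i j c, K * #|[set v : {ffun 'I_3 -> T} | ~~ cut_rule i j c v]| <= n ^ 3.
Proof.
move=> K1 n0 hK.
pose U := ({ffun 'I_3 -> T} * {ffun 'I_6 -> T})%type.
have cardU : #|{: U}| = n ^ 9 by rewrite card_prod !card_ffun !card_ord -expnD.
have cardV : #|{ffun 'I_3 -> T}| = n ^ 3 by rewrite card_ffun !card_ord.
have [] := @exists_small_fibre U _ (fun u v => glue u v \in hits I12 S) K.
- by rewrite cardU expn_gt0 n0.
- rewrite cardU cardV -expnD; apply: leq_trans hK; rewrite leq_mul2l; apply/orP; right.
  rewrite -(card_imset (f := fun uv : U * {ffun 'I_3 -> T} => glue uv.1 uv.2)).
    by apply/subset_leq_card/subsetP => _ /imsetP[uv + ->]; rewrite inE.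
  move=> [[u1 u2] v] [[u1' u2'] v'] /ffunP e.
  congr (_, _, _); apply/ffunP => l.
  + by have := e (inl l); rewrite !ffunE.
  + by have := e (inr (inl l)); rewrite !ffunE.
  + by have := e (inr (inr l)); rewrite !ffunE.
move=> u; rewrite cardV => hu.
have [v0 good0] : exists v0, glue u v0 \notin hits I12 S.
  apply/existsP; rewrite -[X in is_true X]negbK negb_exists; apply/negP => /forallP all_bad.
  move: hu; rewrite (_ : [set _ | _] = setT); last first.
    by apply/setP => v; rewrite !inE; have := all_bad v; rewrite negbK inE.
  rewrite cardsT cardV leqNgt => /negP[].
  by rewrite -[ltnLHS]mul1n ltn_pmul2r // expn_gt0 n0.
have [i [j [c rule]]] := glue_cut good0; exists i, j, c.
apply: leq_trans hu; rewrite leq_mul2l; apply/orP; right.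
apply/subset_leq_card/subsetP => v; rewrite inE [in X in _ -> X]inE; apply: contraNT.
exact: rule.
Qed.

(** The sides of the cut are the two values of [colour3 i j x], and [c] is the
    colour inside the sides. *)
Lemma cut_recolouring i j c : exists X Y : {set T},
  [/\ X :|: Y = [set: T], [disjoint X & Y]
    & exists2 col' : colouring n,
      #|changed col col'| <= #|[set v : {ffun 'I_3 -> T} | ~~ cut_rule i j c v]|
      & partition_coloured col' X Y].
Proof.
pose X := [set x | colour3 i j x == c].
exists X, (~: X); split; first exact: setUCr.
  by rewrite disjoints_subset setCK.
pose inside (e : {set T}) := (e \subset X) || (e \subset ~: X).
exists [ffun e : edge n => if inside (val e) then c else ~~ c]; last first.
  exists c => e; rewrite ffunE; split; first by rewrite /inside => ->.
  rewrite /inside => /andP[meetX meetC]; rewrite ifF //; apply/norP; split.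
    by apply: contraNN meetC => sub; rewrite setI_eq0 disjoints_subset setCK.
  by apply: contraNN meetX; rewrite setI_eq0 disjoints_subset.
rewrite -(card_imset _ (val_inj : injective (val : edge n -> _))).
pose edge_of (v : {ffun 'I_3 -> T}) := [set v (o3 0); v (o3 1); v (o3 2)].
apply: leq_trans (leq_imset_card edge_of _).
apply/subset_leq_card/subsetP => _ /imsetP[e eC ->].
have [x [y [z exyz]]] : exists x y z, val e = [set x; y; z].
  have := valP e; have := set_enum (val e); rewrite cardE.
  case: (enum (val e)) => [|x [|y [|z []]]] // <- _; exists x, y, z.
  by apply/setP => a; rewrite !inE orbA.
have col_e : col e = colour3 x y z by rewrite /colour3 -exyz /set_colour valK.
pose v := [ffun k : 'I_3 => nth x [:: x; y; z] k].
have [v0 v1 v2] : [/\ v (o3 0) = x, v (o3 1) = y & v (o3 2) = z].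
  by rewrite !ffunE !inordK.
apply/imsetP; exists v; last by rewrite /edge_of v0 v1 v2.
move: eC; rewrite !inE ffunE /inside /cut_rule v0 v1 v2 exyz !subUset !sub1set !inE -col_e.
clear inside X.
by case: c; do 3 case: (colour3 _ _ _); case: (col e).
Qed.
End Cut.

(** Here [A], [C], [E] stand for the powers [12 ^ 6], [7 ^ 6], [6 ^ 6], kept
    abstract because they are too large for unary arithmetic; [g], [b], [j] count
    the gadgets, the unbalanced tuples and the exceptional tuples. The choice
    [M = 2 K A] absorbs the term [n ^ 6] in the bound for [j]. *)
Lemma constants_suffice A C E K n g b j : 0 < K -> 0 < A ->
  let M := 2 * K * A in let Q := M + M ^ 2 * C in
  b <= E * g + 36 * n ^ 5 -> M * j <= n ^ 6 + M ^ 2 * (C * b) ->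
  2 * Q * E * g <= n ^ 6 -> 72 * Q <= n ->
  K * (A * (n ^ 6 * (b + j))) <= n ^ 12.
Proof.
move=> K0 A0 M Q hb hj hg hn.
have hQ : 2 * Q * (36 * n ^ 5) <= n ^ 6.
  by rewrite (expnS n 5) mulnA leq_mul2r mulnAC hn orbT.
have hQb : Q * b <= n ^ 6.
  have : 2 * (Q * b) <= 2 * n ^ 6; last by rewrite leq_pmul2l.
  apply: (@leq_trans (2 * Q * (E * g + 36 * n ^ 5))).
    by rewrite mulnA leq_mul2l hb orbT.
  by rewrite mulnDr mulnA (mul2n (n ^ 6)) -addnn leq_add.
have hM : M * (b + j) <= 2 * n ^ 6.
  rewrite mulnDr; apply: leq_trans (leq_add (leqnn _) hj) _.
  by rewrite addnCA mulnA -mulnDl (mul2n (n ^ 6)) -addnn leq_add2l.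
rewrite mulnA mulnCA -[12]/(6 + 6)%N expnD leq_mul2l; apply/orP; right.
by move: hM; rewrite /M -(mulnA 2 K) -(mulnA 2 (K * A)) leq_pmul2l.
Qed.

Local Open Scope ring_scope.
Unset Implicit Arguments.

Theorem theorem3p1 (R : realType) (alpha : R) (halpha : 0 < alpha) :
  exists2 delta : R, 0 < delta &
  exists n0 : nat, forall n : nat, (n0 <= n)%N -> forall col : colouring n,
    delta * n%:R ^+ 6 <= #|gadgets col|%:R
    \/
    exists X Y : {set 'I_n},
      [/\ X :|: Y = [set: 'I_n], [disjoint X & Y]
        & exists2 col' : colouring n,
            #|changed col col'|%:R <= alpha * n%:R ^+ 3
            & partition_coloured col' X Y].
Proof.
have [K K1 hK] : exists2 K : nat, (1 < K)%N & 1 <= alpha * K%:R.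
  exists (Num.bound alpha^-1).+2 => //.
  rewrite -ler_pdivrMl // mulr1; apply/ltW/(lt_le_trans (archi_boundP _)).
    by rewrite invr_ge0 ltW.
  by rewrite ler_nat -addn2 leq_addr.
(* The powers are hidden behind equations so that they are never computed. *)
have [A eA] : exists A, A = expn 12 6 by exists (expn 12 6).
have [C eC] : exists C, C = expn 7 6 by exists (expn 7 6).
have [E eE] : exists E, E = expn 6 6 by exists (expn 6 6).
have A0 : (0 < A)%N by rewrite eA expn_gt0.
have E0 : (0 < E)%N by rewrite eE expn_gt0.
pose M := (2 * K * A)%N; pose Q := (M + M ^ 2 * C)%N.
have Q0 : (0 < Q)%N by rewrite addn_gt0 /M !muln_gt0 A0 (ltnW K1).
have D0 : (0 < 2 * Q * E)%N by rewrite !muln_gt0 Q0 E0.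
exists (2 * Q * E)%:R^-1; first by rewrite invr_gt0 ltr0n.
exists (72 * Q)%N => n hn col.
have n0 : (0 < n)%N by apply: leq_trans hn; rewrite muln_gt0 Q0.
case: lerP => [|few]; [by left | right].
have hg : (2 * Q * E * #|gadgets col| <= n ^ 6)%N.
  by rewrite -(ler_nat R) natrM natrX -ler_pdivlMl ?ltr0n // ltW.
(* 12 = 3 + (6 + 3) positions, and at most 12 ^ 6 choices of six of them. *)
have hhits : (K * #|hits ('I_3 + ('I_6 + 'I_3))%type (unbalanced6 col :|: jump6 col)| <= n ^ 12)%N.
  have hbad := card_unbalanced6 col; have hjump := card_jump6 col M.
  rewrite -eE in hbad; rewrite -eC in hjump.
  apply: leq_trans (constants_suffice (ltnW K1) A0 hbad hjump hg hn).
  have := card_hits ('I_3 + ('I_6 + 'I_3))%type (unbalanced6 col :|: jump6 col).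
  rewrite !card_sum !card_ord -[(3 + (6 + 3))%N]/12%N -eA => h.
  rewrite leq_mul2l; apply/orP; right; apply: leq_trans h _.
  by rewrite !leq_mul2l leq_card_setU !orbT.
have [i [j [c few_breakers]]] := few_rule_breakers K1 n0 hhits.
have [X [Y [XY dXY [col' hcol' part]]]] := cut_recolouring col i j c.
exists X, Y; split=> //; exists col' => //.
have h : (K * #|changed col col'| <= n ^ 3)%N.
  by apply: leq_trans few_breakers; rewrite leq_mul2l hcol' orbT.
have h' : K%:R * #|changed col col'|%:R <= n%:R ^+ 3 :> R by rewrite -natrM -natrX ler_nat.
apply: le_trans (ler_wpM2l (ltW halpha) h'); rewrite mulrA -[leLHS]mul1r.
by rewrite ler_wpM2r.
Qed.
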